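(* Let $A$ be an artinian ring and let $\zeta(A)=\zeta(A,\sim_A)$. Then $A$ is a principal ideal ring if and only if $\zeta(A)$ is isomorphic to a finite product of staircase graphs.
   Context: All rings are commutative and unitary. For $a,b\in A$, $a\sim_A b$ iff $(a)=(b)$ as ideals. $\zeta(A,\sim_A)$ is the graph (loops allowed) with vertex set $A/\!\sim_A$ in which $[a],[b]$ are adjacent iff $ab=0$ (well defined). Graph isomorphisms are bijections on vertices preserving adjacency in both directions. The product $G_1\times G_2$ of graphs has vertex set $V(G_1)\times V(G_2)$, with two pairs adjacent iff both components are adjacent. For an integer $k\geq 0$, the staircase graph $SG_k$ has vertex set $\{0,\dots,k\}$, with $i$ adjacent to $j$ iff $i+j\geq k$ (loops, $i=j$, included). *)

(* Defs.v *)
From HB Require Import structures.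
From mathcomp Require Import all_boot all_order all_algebra generic_quotient.
From mathcomp Require Import boolp classical_sets.

Set Implicit Arguments.
Unset Strict Implicit.
Unset Printing Implicit Defensive.

Import GRing.Theory.

Local Open Scope ring_scope.
Local Open Scope classical_set_scope.
Local Open Scope quotient_scope.

(* Rings are [comPzRingType]s, so that the zero ring is not excluded.
   [idealr_closed] of ring_quotient describes proper ideals only, hence the
   following definition. *)
Definition is_ideal (A : comPzRingType) (I : set A) : Prop :=
  [/\ I 0, (forall x y, I x -> I y -> I (x + y)) &
      (forall r x, I x -> I (r * x))].

Definition principal_ideal (A : comPzRingType) (a : A) : set A :=
  [set x | exists r, x = r * a].

Definition artinian (A : comPzRingType) : Prop :=
  forall I : nat -> set A,
    (forall n, is_ideal (I n)) ->
    (forall n, I n.+1 `<=` I n) ->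
    exists n, forall m, (n <= m)%N -> I m = I n.

Definition principal_ideal_ring (A : comPzRingType) : Prop :=
  forall I : set A, is_ideal I -> exists a : A, I = principal_ideal a.

(* Undirected graphs, possibly with loops. *)
Record graph := Graph {
  vertex :> Type;
  adj : vertex -> vertex -> Prop;
  adj_sym : forall x y, adj x y -> adj y x
}.

Definition graph_iso (G H : graph) : Prop :=
  exists f : G -> H, bijective f /\ forall x y, adj x y <-> adj (f x) (f y).

Definition prod_adj (G H : graph) (x y : G * H) : Prop :=
  adj x.1 y.1 /\ adj x.2 y.2.

Lemma prod_adj_sym (G H : graph) (x y : G * H) : prod_adj x y -> prod_adj y x.
Proof. by case=> h1 h2; split; apply: adj_sym. Qed.

Definition prod_graph (G H : graph) : graph :=
  @Graph (G * H)%type (@prod_adj G H) (@prod_adj_sym G H).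

(* The empty product: one vertex carrying a loop. *)
Definition unit_graph : graph :=
  @Graph unit (fun _ _ => True) (fun _ _ _ => I).

Definition staircase_adj (k : nat) (i j : 'I_k.+1) : Prop := (k <= i + j)%N.

Lemma staircase_adj_sym (k : nat) (i j : 'I_k.+1) :
  staircase_adj i j -> staircase_adj j i.
Proof. by rewrite /staircase_adj addnC. Qed.

Definition staircase (k : nat) : graph :=
  @Graph 'I_k.+1 (@staircase_adj k) (@staircase_adj_sym k).

Definition staircase_product (ks : seq nat) : graph :=
  foldr prod_graph unit_graph [seq staircase k | k <- ks].

(* The empty product is itself a staircase graph, so it makes no difference
   whether empty products are allowed. *)
Lemma unit_graph_staircase : graph_iso unit_graph (staircase 0).
Proof.
exists (fun _ => ord0); split=> //.
by exists (fun _ => tt) => [[]|x] //; apply/esym/(ord1 x).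
Qed.

Section Zeta.
Variable A : comPzRingType.

Definition sim (a b : A) : bool := `[< principal_ideal a = principal_ideal b >].

Lemma sim_refl : reflexive sim.
Proof. by move=> a; apply/asboolP. Qed.

Lemma sim_sym : symmetric sim.
Proof. by move=> a b; apply/asboolP/asboolP. Qed.

Lemma sim_trans : transitive sim.
Proof. by move=> b a c /asboolP hab /asboolP hbc; apply/asboolP; rewrite hab. Qed.

Canonical sim_equiv := EquivRel sim sim_refl sim_sym sim_trans.

Definition sim_quot := {eq_quot sim_equiv}.

Lemma sim_mul_eq0 (a a' b b' : A) :
  sim a a' -> sim b b' -> a * b = 0 -> a' * b' = 0.
Proof.
move=> /asboolP ha /asboolP hb ab0.
have [r ->] : principal_ideal a a' by rewrite ha; exists 1; rewrite mul1r.
have [s ->] : principal_ideal b b' by rewrite hb; exists 1; rewrite mul1r.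
by rewrite mulrACA ab0 mulr0.
Qed.

Definition zeta_adj (u v : sim_quot) : Prop := repr u * repr v = 0.

Lemma zeta_adj_sym (u v : sim_quot) : zeta_adj u v -> zeta_adj v u.
Proof. by rewrite /zeta_adj mulrC. Qed.

Definition zeta : graph := @Graph sim_quot zeta_adj zeta_adj_sym.

(* Adjacency does not depend on the representatives chosen by [repr]. *)
Lemma zeta_adjE (a b : A) :
  @adj zeta (\pi_sim_quot a) (\pi_sim_quot b) <-> a * b = 0.
Proof.
have h (c : A) : sim (repr (\pi_sim_quot c)) c.
  by apply/(@eqmodP _ sim_equiv); rewrite reprK.
by split; apply: sim_mul_eq0; rewrite // sim_sym.
Qed.

End Zeta.

(* Main.v *)
Require Import Defs.
From mathcomp Require Import all_boot all_order all_algebra.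
From mathcomp Require Import generic_quotient boolp classical_sets ring.

(** An isomorphism from zeta(A) onto a product of staircases amounts to giving
every a in A a tuple of coordinates v a, ranging over all tuples bounded by ks,
which determines the ideal (a) and satisfies
a b = 0 iff ks_i <= v a i + v b i for all i ([graph_iso_coordsP]).

If A is an artinian principal ideal ring, the descending chain condition gives
1 = e_1 + ... + e_n with orthogonal primitive idempotents e_i
([exists_decomposition]). Each e_i A is local with nilpotent principal maximal
ideal (p_i), so that, up to a unit, its elements are the powers of p_i
([primitive_uniserial]). The i-th coordinate of a is the exponent j for which
(a e_i) = (e_i p_i ^ j) ([decomposition_coords]).

Conversely, suppose that A has staircase coordinates. Replacing a tuple d by
ks - d turns the adjacency rule into an order rule: v x <= v y coordinatewise
iff ann(x) is contained in ann(y) ([coords_leP]); in particular elements with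
the same annihilator generate the same ideal. Among the elements supported at
a single index the annihilators form a chain, and there ann(x) <= ann(y)
already forces y to be a multiple of x: if the inclusion is strict, then x + y
has the same annihilator as x, hence (x + y) = (x) ([supported_at_dvd]).
Finally, the elements with coordinate 0 at one index and maximal coordinates
elsewhere are pairwise orthogonal and add up to a unit, so they split A into
such chain pieces ([exists_supported_family]). An ideal is then generated by
the sum of one element of it in each piece, chosen with least coordinate ([staircase_coords_principal]). *)

Set Implicit Arguments.
Unset Strict Implicit.
Unset Printing Implicit Defensive.

Import GRing.Theory.

(** * Principal ideals *)

Lemma principal_ideal_ideal (A : comPzRingType) (a : A) :
  is_ideal (principal_ideal a).
Proof.
split.
- by exists 0%R; rewrite mul0r.
- by move=> _ _ [r ->] [s ->]; exists (r + s)%R; rewrite mulrDl.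
- by move=> t _ [r ->]; exists (t * r)%R; rewrite mulrA.
Qed.

Lemma principal_ideal_refl (A : comPzRingType) (a : A) : principal_ideal a a.
Proof. by exists 1%R; rewrite mul1r. Qed.

Lemma principal_ideal_subset (A : comPzRingType) (a b : A) :
  principal_ideal b a -> (principal_ideal a `<=` principal_ideal b)%classic.
Proof. by move=> [r ->] _ [s ->]; exists (s * r)%R; rewrite mulrA. Qed.

Lemma principal_ideal_eq (A : comPzRingType) (a b : A) :
  principal_ideal b a -> principal_ideal a b ->
  principal_ideal a = principal_ideal b.
Proof. by move=> ab ba; apply/seteqP; split; apply: principal_ideal_subset. Qed.

Lemma principal_ideal_eq_mem (A : comPzRingType) (a b : A) :
  principal_ideal a = principal_ideal b -> principal_ideal b a.
Proof. by move=> <-; apply: principal_ideal_refl. Qed.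

Lemma principal_ideal_mul_eq0 (A : comPzRingType) (a b z : A) :
  principal_ideal b a -> (z * b = 0)%R -> (z * a = 0)%R.
Proof. by move=> [r ->] zb0; rewrite mulrCA zb0 mulr0. Qed.

(** * Staircase coordinates *)

Definition bounded_by (ks : seq nat) (d : nat -> nat) : Prop :=
  forall i, i < size ks -> d i <= nth 0 ks i.

Definition eq_below (n : nat) (d d' : nat -> nat) : Prop :=
  forall i, i < n -> d i = d' i.

(** Coordinates are total functions on nat, of which only the values below
[size ks] matter; this avoids casts between the finite index types attached to
the lists that appear below. *)
Record staircase_coords (A : comPzRingType) (ks : seq nat)
    (v : A -> nat -> nat) : Prop := StaircaseCoords {
  coords_bounded : forall a, bounded_by ks (v a);
  coords_surj : forall d, bounded_by ks d ->
    exists a, eq_below (size ks) (v a) d;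
  coords_inj : forall a b, eq_below (size ks) (v a) (v b) ->
    principal_ideal a = principal_ideal b;
  coords_mul_eq0 : forall a b, (a * b = 0)%R <->
    forall i, i < size ks -> nth 0 ks i <= v a i + v b i }.

Fixpoint vertex_coord (ks : seq nat) : staircase_product ks -> nat -> nat :=
  match ks with
  | [::] => fun _ _ => 0
  | k :: ks' => fun x i =>
      if i is j.+1 then @vertex_coord ks' x.2 j else (x.1 : 'I_k.+1)
  end.

Fixpoint coord_vertex (ks : seq nat) (d : nat -> nat) :
    staircase_product ks :=
  match ks with
  | [::] => tt
  | k :: ks' => (inord (d 0) : 'I_k.+1, coord_vertex ks' (fun i => d i.+1))
  end.

Lemma vertex_coord_bounded ks (x : staircase_product ks) :
  bounded_by ks (vertex_coord x).
Proof.
elim: ks x => [|k ks IH] x [|i] //=; first by move=> _; rewrite -ltnS ltn_ord.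
exact: IH.
Qed.

Lemma coord_vertexK ks d : bounded_by ks d ->
  eq_below (size ks) (vertex_coord (coord_vertex ks d)) d.
Proof.
elim: ks d => [|k ks IH] d dks [|i] //= ik; first by rewrite inordK // ltnS (dks 0).
by apply: IH => // j jk; apply: (dks j.+1).
Qed.

Lemma vertex_coord_inj ks (x y : staircase_product ks) :
  eq_below (size ks) (vertex_coord x) (vertex_coord y) -> x = y.
Proof.
elim: ks x y => [|k ks IH] /=; first by move=> [] [].
move=> [x1 x2] [y1 y2] exy; congr pair; first exact/val_inj/(exy 0).
by apply: IH => i ik; apply: (exy i.+1).
Qed.

Lemma adj_vertex_coord ks (x y : staircase_product ks) :
  adj x y <->
  forall i, i < size ks -> nth 0 ks i <= vertex_coord x i + vertex_coord y i.
Proof.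
elim: ks x y => [|k ks IH] x y /=; first by split.
split=> [[h1 h2] [|i] //= ik|h]; first by move/IH: h2; apply.
by split; [apply: (h 0) | apply/IH => i ik; apply: (h i.+1)].
Qed.

Section Coordinates.
Variables (A : comPzRingType) (ks : seq nat) (v : A -> nat -> nat).
Hypothesis hv : staircase_coords ks v.
Let n := size ks.

(** The backward direction tests the inclusion on an element z with coordinates
ks - v x, the least possible ones for an element that annihilates x. *)
Lemma coords_leP (x y : A) :
  (forall i, i < n -> v x i <= v y i) <->
  (forall z, (z * x = 0)%R -> (z * y = 0)%R).
Proof.
split=> [le_xy z /(coords_mul_eq0 hv) zx0|sub_xy i ik].
  apply/(coords_mul_eq0 hv) => i ik.
  by apply: leq_trans (zx0 i ik) _; rewrite leq_add2l le_xy.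
have [|z zE] := @coords_surj _ _ _ hv (fun j => nth 0 ks j - v x j).
  by move=> j jk; rewrite leq_subr.
have /sub_xy /(coords_mul_eq0 hv) : (z * x = 0)%R.
  by apply/(coords_mul_eq0 hv) => j jk; rewrite zE // subnK // (coords_bounded hv).
move=> /(_ i ik); rewrite zE // => h.
by rewrite -(leq_add2l (nth 0 ks i - v x i)) subnK // (coords_bounded hv).
Qed.

Lemma coords_anti (x y : A) :
  (forall z, (z * x = 0)%R <-> (z * y = 0)%R) ->
  eq_below n (v x) (v y).
Proof.
move=> h i ik; apply/eqP; rewrite eqn_leq.
by apply/andP; split; move: i ik; apply/coords_leP => z /h.
Qed.

Lemma coords_eq (x y : A) :
  principal_ideal x = principal_ideal y -> eq_below n (v x) (v y).
Proof.
move=> exy; apply: coords_anti => z.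
split; apply: principal_ideal_mul_eq0; first exact/principal_ideal_eq_mem/esym.
exact: principal_ideal_eq_mem.
Qed.

(** Elements living in the i-th factor: maximal coordinates are those of 0. *)
Definition supported_at (i : nat) (x : A) : Prop :=
  forall j, j < n -> j != i -> v x j = nth 0 ks j.

Lemma supported_atP i (x : A) :
  (forall j, j < n -> j != i -> nth 0 ks j <= v x j) -> supported_at i x.
Proof.
by move=> h j jk ji; apply/eqP; rewrite eqn_leq h // (coords_bounded hv).
Qed.

Lemma supported_at_ann i (x y : A) : supported_at i x ->
  (forall z, (z * x = 0)%R -> (z * y = 0)%R) -> supported_at i y.
Proof.
move=> sx /coords_leP le_xy; apply: supported_atP => j jk ji.
by rewrite -(sx j jk ji) le_xy.
Qed.

Lemma supported_at_mul0 i j (x y : A) :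
  supported_at i x -> supported_at j y -> i != j -> (x * y = 0)%R.
Proof.
move=> sx sy ij; apply/(coords_mul_eq0 hv) => l lk.
have [li|li] := eqVneq l i; last by rewrite (sx l) // leq_addr.
by rewrite (sy l) ?leq_addl // li.
Qed.

Lemma supported_at_le i (x y : A) : i < n ->
  supported_at i x -> supported_at i y -> v x i <= v y i ->
  forall z, (z * x = 0)%R -> (z * y = 0)%R.
Proof.
move=> ik sx sy le_i; apply/coords_leP => j jk.
by have [->//|ji] := eqVneq j i; rewrite sx // sy.
Qed.

(** The heart of the converse. When v x i < v y i, the inclusion
ann(x) <= ann(y) gives ann(x) <= ann(x + y). Since annihilators are totally
ordered at i, either ann(y) <= ann(x + y), which yields ann(y) <= ann(x) and
contradicts v x i < v y i, or ann(x + y) <= ann(y), which yields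
ann(x + y) <= ann(x). So x and x + y generate the same ideal. *)
Lemma supported_at_dvd i (x y : A) : i < n ->
  supported_at i x -> supported_at i y -> v x i <= v y i ->
  principal_ideal x y.
Proof.
move=> ik sx sy le_i; have ann_xy := supported_at_le ik sx sy le_i.
have [eq_i|ne_i] := eqVneq (v x i) (v y i).
  rewrite (@coords_inj _ _ _ hv x y); first exact: principal_ideal_refl.
  by move=> j jk; have [->//|ji] := eqVneq j i; rewrite sx // sy.
have lt_i : v x i < v y i by rewrite ltn_neqAle ne_i.
have ann_xs z : (z * x = 0)%R -> (z * (x + y) = 0)%R.
  by move=> zx0; rewrite mulrDr zx0 (ann_xy _ zx0) addr0.
have ss : supported_at i (x + y)%R by apply: supported_at_ann ann_xs.
have ann_sx z : (z * (x + y) = 0)%R -> (z * x = 0)%R.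
  (* ann(y) and ann(x + y) are comparable, both elements being supported at i *)
  have [le_ys|lt_sy] := leqP (v y i) (v (x + y)%R i).
    have ann_ys := supported_at_le ik sy ss le_ys.
    have /coords_leP : forall z, (z * y = 0)%R -> (z * x = 0)%R.
      by move=> t ty0; have := ann_ys t ty0; rewrite mulrDr ty0 addr0.
    by move=> /(_ i ik); rewrite leqNgt lt_i.
  move=> zs0; have zy0 := supported_at_le ik ss sy (ltnW lt_sy) zs0.
  by move: zs0; rewrite mulrDr zy0 addr0.
have [|r rE] := @principal_ideal_eq_mem _ (x + y)%R x.
  by apply: (coords_inj hv); apply: coords_anti => z; split; [exact: ann_sx | exact: ann_xs].
by exists (r - 1)%R; rewrite mulrBl mul1r -rE; ring.
Qed.

(** Up to the unit u, these are the idempotents of the product decomposition of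
A. Only 0 annihilates all the x_i, as x_i has coordinate 0 at i; hence the sum s of
the x_i has the annihilator, and so the ideal, of 1. *)
Lemma exists_supported_family : exists x : nat -> A,
  (forall i, supported_at i (x i)) /\ (exists u, u * \sum_(i < n) x i = 1)%R.
Proof.
have [x xE] : exists x : nat -> A, forall i,
    eq_below n (v (x i)) (fun j => if j == i then 0 else nth 0 ks j).
  have h i : exists a, eq_below n (v a) (fun j => if j == i then 0 else nth 0 ks j).
    by apply: (coords_surj hv) => j jk; case: ifP.
  by have [x xE] := choice h; exists x.
have sx i : supported_at i (x i) by move=> j jk ji; rewrite xE // (negPf ji).
exists x; split=> //.
set s := (\sum_(i < n) x i)%R.
have sxM i : i < n -> (s * x i = x i * x i)%R.
  move=> ik; rewrite mulr_suml (bigD1 (Ordinal ik)) //= big1 ?addr0 // => j ji.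
  by apply: supported_at_mul0 (sx j) (sx i) _; rewrite -val_eqE in ji.
have ann_all y : (forall i, i < n -> (y * x i = 0)%R) -> y = 0%R.
  move=> h; rewrite -[y]mulr1; apply/(coords_mul_eq0 hv) => i ik.
  have /(coords_mul_eq0 hv)/(_ i ik) := h i ik.
  by rewrite xE // eqxx addn0 => h1; apply: leq_trans h1 (leq_addr _ _).
have ann_s z : (z * s = 0)%R -> z = 0%R.
  move=> zs0; apply: (ann_all) => i ik; apply: (ann_all) => j jk.
  have [->|ji] := eqVneq j i; first by rewrite -mulrA -sxM // mulrA zs0 mul0r.
  by rewrite -mulrA (supported_at_mul0 (sx i) (sx j)) ?mulr0 // eq_sym.
have [|u uE] := @principal_ideal_eq_mem _ 1%R s; last by exists u.
apply: (coords_inj hv); apply: coords_anti => z; rewrite mulr1.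
by split=> [->|/ann_s //]; rewrite mul0r.
Qed.

(** At each index i let g_i be an element of I supported at i with the least
coordinate. Since g_i = u x_i g_i = u x_i G for G the sum of the g_i, the
single element G generates all of them. *)
Lemma staircase_coords_principal : principal_ideal_ring A.
Proof.
move=> I [I0 ID IM].
have [x [sx [u us1]]] := exists_supported_family.
have /choice [g gP] : forall i, exists g, i < n ->
    [/\ I g, supported_at i g &
        forall y, I y -> supported_at i y -> v g i <= v y i].
  move=> i; have [ik|] := boolP (i < n); last by exists 0%R.
  pose P m := `[< exists y, [/\ I y, supported_at i y & v y i = m] >].
  have exP : exists m, P m.
    exists (v 0%R i); apply/asboolP; exists 0%R; split=> //.
    by apply: supported_at_ann (sx i) _ => z _; rewrite mulr0.
  have [_ /asboolP [g [Ig sg <-]] min] := ex_minnP exP.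
  exists g => _; split=> // y Iy sy.
  by apply: min; apply/asboolP; exists y.
pose G := (\sum_(i < n) g i)%R.
have IG : I G by apply: (big_ind I) => // i _; have [] := gP i (ltn_ord i).
have xg i j : i < n -> j < n -> i != j -> (x i * g j = 0)%R.
  by move=> ik jk; have [_ sg _] := gP j jk; apply: supported_at_mul0 (sx i) sg.
have Gg i : i < n -> principal_ideal G (g i).
  move=> ik; exists (u * x i)%R.
  rewrite -mulrA mulr_sumr (bigD1 (Ordinal ik)) //= big1 ?addr0; last first.
    by move=> j; rewrite -val_eqE eq_sym => ji; apply: xg.
  rewrite -[g i in LHS]mul1r -us1 -mulrA mulr_suml (bigD1 (Ordinal ik)) //=.
  rewrite big1 ?addr0 // => j.
  by rewrite -val_eqE => ji; apply: xg.
exists G; apply/seteqP; split=> [b Ib|_ [r ->]]; last exact: IM.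
have [GI0 GID GIM] := principal_ideal_ideal G.
rewrite -[b]mul1r -us1 -mulrA; apply: GIM; rewrite mulr_suml.
apply: (big_ind (principal_ideal G)) => // i _.
have ik := ltn_ord i; have [Ig sg min] := gP i ik.
have sxb : supported_at i (x i * b)%R.
  by apply: supported_at_ann (sx i) _ => z zx0; rewrite mulrA zx0 mul0r.
apply: principal_ideal_subset (Gg i ik) _ _.
apply: (supported_at_dvd ik sg sxb); apply: min => //.
exact: IM.
Qed.

End Coordinates.

Lemma sim_reprP (A : comPzRingType) (a : A) :
  principal_ideal (repr (\pi_(sim_quot A) a)%qT) = principal_ideal a.
Proof.
by apply/asboolP; apply/(@eqmodP _ (sim_equiv A)); rewrite reprK.
Qed.

Lemma graph_iso_coordsP (A : comPzRingType) (ks : seq nat) :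
  graph_iso (zeta A) (staircase_product ks) <->
  exists v : A -> nat -> nat, staircase_coords ks v.
Proof.
split=> [[f [[g fK gK] fadj]]|[v hv]].
  exists (fun a => vertex_coord (f (\pi_(sim_quot A) a)%qT)); split.
  - by move=> a; apply: vertex_coord_bounded.
  - move=> d dks; exists (repr (g (coord_vertex ks d))).
    by rewrite reprK gK; apply: coord_vertexK.
  - move=> a b /vertex_coord_inj /(can_inj fK) eab.
    by rewrite -(sim_reprP a) eab sim_reprP.
  - by move=> a b; rewrite -zeta_adjE -adj_vertex_coord fadj.
pose f (q : zeta A) := coord_vertex ks (v (repr q)).
have fE q : eq_below (size ks) (vertex_coord (f q)) (v (repr q)).
  by apply: coord_vertexK; apply: (coords_bounded hv).
exists f; split; last first.
  move=> p q; rewrite adj_vertex_coord; apply: (iff_trans (coords_mul_eq0 hv _ _)).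
  by split=> h i ik; move: (h i ik); rewrite !fE.
have [g gP] : exists g : staircase_product ks -> A,
    forall x, eq_below (size ks) (v (g x)) (vertex_coord x).
  have h (x : staircase_product ks) :
      exists a, eq_below (size ks) (v a) (vertex_coord x).
    by apply: (coords_surj hv); apply: vertex_coord_bounded.
  by have [g gP] := choice h; exists g.
have gK : cancel (fun x => \pi_(sim_quot A) (g x))%qT f.
  move=> x; apply: vertex_coord_inj => i ik; rewrite fE // -gP //.
  exact: (coords_eq hv (sim_reprP (g x))).
exists (fun x => \pi_(sim_quot A) (g x))%qT => // q.
rewrite -[RHS]reprK; apply/(@eqmodP _ (sim_equiv A)); apply/asboolP.
by apply: (coords_inj hv) => i ik; rewrite gP // fE.
Qed.

(** * Decomposition of artinian principal ideal rings *)

Local Open Scope ring_scope.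

Definition principal_ideal_lt (A : comPzRingType) (a b : A) : Prop :=
  principal_ideal b a /\ ~ principal_ideal a b.

Lemma artinian_wf (A : comPzRingType) :
  artinian A -> well_founded (@principal_ideal_lt A).
Proof.
move=> hA a; apply: contrapT => na.
have next (x : A) : exists y, ~ Acc (@principal_ideal_lt A) x ->
    principal_ideal_lt y x /\ ~ Acc (@principal_ideal_lt A) y.
  have [ax|nx] := pselect (Acc (@principal_ideal_lt A) x); first by exists 0.
  suff [y yP] : exists y,
    principal_ideal_lt y x /\ ~ Acc (@principal_ideal_lt A) y by exists y.
  apply: contrapT => h; apply: nx; constructor=> y yx.
  by apply: contrapT => ny; apply: h; exists y.
have [F FP] := choice next.
pose s m := iter m F a.
have ns m : ~ Acc (@principal_ideal_lt A) (s m) by elim: m => //= m /FP [].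
have ss m : principal_ideal_lt (s m.+1) (s m) by have [] := FP _ (ns m).
have [||m /(_ m.+1 (leqnSn m)) eqI] := hA (fun m => principal_ideal (s m)).
- by move=> m; apply: principal_ideal_ideal.
- by move=> m; apply: principal_ideal_subset; have [] := ss m.
have [_ []] := ss m.
exact/principal_ideal_eq_mem/esym.
Qed.

(** Fitting's lemma: once (a ^ m) = (a ^ (m + 1)) with a ^ m = r a ^ (m + 1),
the element (r a) ^ m is idempotent and acts as the identity on a ^ m. *)
Lemma artinian_idempotent (A : comPzRingType) (a : A) : artinian A ->
  exists e n, [/\ e * e = e, principal_ideal a e & a ^+ n = a ^+ n * e].
Proof.
move=> hA.
(* exponents start at 1, so that the idempotent is a multiple of a *)
have [||n /(_ n.+1 (leqnSn n)) eqI] := hA (fun n => principal_ideal (a ^+ n.+1)).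
- by move=> n; apply: principal_ideal_ideal.
- by move=> n; apply: principal_ideal_subset; exists a; rewrite [LHS]exprS.
set m := n.+1 in eqI.
have [r rE] : principal_ideal (a ^+ m.+1) (a ^+ m).
  exact/principal_ideal_eq_mem/esym.
have rjE j : a ^+ m = r ^+ j * a ^+ (m + j).
  elim: j => [|j IH]; first by rewrite expr0 mul1r addn0.
  rewrite {1}IH exprD {1}rE addnS !exprS exprD; ring.
have amE : a ^+ m = a ^+ m * (r ^+ m * a ^+ m) by rewrite {1}(rjE m) exprD; ring.
exists (r ^+ m * a ^+ m), m; split=> //.
- by rewrite mulrAC mulrA -[_ * r ^+ m * _]mulrA -mulrA mulrCA -mulrA -amE.
- by exists (r ^+ m * a ^+ n); rewrite -mulrA -exprSr.
Qed.

(** The factor e A is a chain ring of length k with uniformizer p. The case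
k = 0 forces e = 0. *)
Definition uniserial_idempotent (A : comPzRingType) (t : A * A * nat) : Prop :=
  let: (e, p, k) := t in
  [/\ e * e = e, e * p ^+ k = 0,
      (forall j, (j < k)%N -> e * p ^+ j <> 0) &
      forall x, exists2 j, (j <= k)%N &
        principal_ideal (x * e) = principal_ideal (e * p ^+ j)].

(** A primitive idempotent e makes e A local with nil maximal ideal: the
Fitting idempotent of x in e A is either e or 0. *)
Lemma primitive_dichotomy (A : comPzRingType) (e : A) : artinian A ->
  e * e = e ->
  (forall f, f * f = f -> f * e = f -> f = 0 \/ f = e) ->
  forall x, principal_ideal e x -> principal_ideal x e \/ exists n, x ^+ n = 0.
Proof.
move=> hA ee prim x [r xE].
have [f [n [ff fx xn]]] := artinian_idempotent x hA.
have fe : f * e = f.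
  by case: fx => s ->; rewrite xE -!mulrA ee.
have [f0|<-] := prim f ff fe; last by left.
by right; exists n; rewrite xn f0 mulr0.
Qed.

(** The non-units of e A form an ideal, hence are the multiples of a nilpotent
p. Dividing x e by p as long as the quotient is not a unit of e A shows that
x e is a unit times a power of p. *)
Lemma primitive_uniserial (A : comPzRingType) (e : A) :
  artinian A -> principal_ideal_ring A ->
  e * e = e -> e <> 0 ->
  (forall f, f * f = f -> f * e = f -> f = 0 \/ f = e) ->
  exists p k, uniserial_idempotent (e, p, k).
Proof.
move=> hA pir ee e0 prim.
have dich := primitive_dichotomy hA ee prim.
have memE x : principal_ideal e x -> x * e = x.
  by move=> [r ->]; rewrite -mulrA ee.
have [eI0 eID eIM] := principal_ideal_ideal e.
pose m : set A := fun x => principal_ideal e x /\ ~ principal_ideal x e.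
have [|p mE] := pir m.
  split.
  - by split=> // -[r]; rewrite mulr0.
  - move=> x y [ex nx] [ey ny]; split; first exact: eID.
    move=> [r eE].
    have [erx|[n rxn]] := dich _ (eIM r x ex).
      by apply: nx; apply: principal_ideal_subset erx; exists r.
    (* e - r x = r y divides e - (r x) ^ n.+1 = e *)
    have en : e ^+ n.+1 = e by elim: (n) => // l IH; rewrite exprS IH.
    have := subrXX e (r * x) n.+1.
    rewrite en (exprS _ n) rxn mulr0 subr0.
    have -> : e - r * x = r * y by rewrite {1}eE; ring.
    move=> eE'; apply: ny; rewrite eE'.
    by exists (r * \sum_(i < n.+1) e ^+ (n.+1.-1 - i) * (r * x) ^+ i); ring.
  - move=> r x [ex nx]; split; first exact: eIM.
    by move=> h; apply: nx; apply: principal_ideal_subset h; exists r.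
have [ep np] : m p by rewrite mE; apply: principal_ideal_refl.
have [//|[N pN]] := dich p ep.
have exk : exists k, e * p ^+ k == 0 by exists N; rewrite pN mulr0.
have [k /eqP pk0 mink] := ex_minnP exk.
exists p, k; split=> //.
  by move=> j jk /eqP /mink; rewrite leqNgt jk.
move=> x.
have step l : (l <= k)%N -> principal_ideal (e * p ^+ l) (x * e) \/
    exists2 j, (j <= k)%N & principal_ideal (x * e) = principal_ideal (e * p ^+ j).
  elim: l => [|l IH] lk.
    by left; exists x; rewrite expr0 mulr1.
  have [[y yE]|] := IH (ltnW lk); last by right.
  have [eye|nye] := pselect (principal_ideal (y * e) e).
    right; exists l; first exact: ltnW.
    rewrite yE; apply: principal_ideal_eq; first by exists y.
    case: eye => r rE; exists r; rewrite {1}rE.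
    by ring.
  have : m (y * e) by split=> //; exists y.
  rewrite mE => -[z zE]; left; exists z.
  by rewrite yE mulrA zE -(memE p ep) exprS; ring: (memE p ep) ee.
have [xe0|//] := step k (leqnn k).
exists k => //; apply: principal_ideal_eq => //.
by exists 0; rewrite mul0r.
Qed.

Record idempotent_decomposition (A : comPzRingType) (f : A)
    (s : seq (A * A * nat)) : Prop := IdempotentDecomposition {
  dec_uniserial : forall t, t \in s -> uniserial_idempotent t;
  dec_sum : \sum_(t <- s) t.1.1 = f;
  dec_sub : forall t, t \in s -> t.1.1 * f = t.1.1;
  dec_orth : pairwise (fun t u : A * A * nat => t.1.1 * u.1.1 == 0) s }.

(** Well-founded induction on (e): an idempotent that is not primitive splits
into two orthogonal ones generating strictly smaller ideals. *)
Lemma exists_decomposition (A : comPzRingType) :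
  artinian A -> principal_ideal_ring A ->
  forall e : A, e * e = e -> exists s, idempotent_decomposition e s.
Proof.
move=> hA pir.
apply: (well_founded_ind (artinian_wf hA)) => e IH ee.
have [->|/eqP e0] := eqVneq e 0.
  by exists [::]; split=> //; rewrite big_nil.
have [prim|] := pselect (forall f, f * f = f -> f * e = f -> f = 0 \/ f = e).
  have [p [k epk]] := primitive_uniserial hA pir ee e0 prim.
  exists [:: (e, p, k)]; split=> //=.
  - by move=> t; rewrite inE => /eqP ->.
  - by rewrite big_seq1.
  - by move=> t; rewrite inE => /eqP ->.
move/existsNP => [f /not_implyP [ff /not_implyP [fe /not_orP [f0 ne]]]].
pose g := e - f.
have gg : g * g = g by rewrite /g; ring: ee ff fe.
have ge : g * e = g by rewrite /g; ring: ee ff fe.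
have fg : f * g = 0 by rewrite /g; ring: ee ff fe.
have gf : g * f = 0 by rewrite mulrC.
have [|//|s1 [u1 sum1 sub1 o1]] := IH f.
  split; first by exists f; rewrite fe.
  by move=> [r eE]; apply: ne; rewrite -fe {1 2}eE mulrCA ff.
have [|//|s2 [u2 sum2 sub2 o2]] := IH g.
  split; first by exists g; rewrite ge.
  move=> [r eE]; apply: f0; rewrite -fe {1}eE mulrCA fg mulr0 //.
exists (s1 ++ s2); split.
- by move=> t; rewrite mem_cat => /orP [/u1|/u2].
- by rewrite big_cat /= sum1 sum2 /g; ring.
- move=> t; rewrite mem_cat => /orP [/sub1|/sub2] <-; rewrite -mulrA.
    by rewrite fe.
  by rewrite ge.
- rewrite pairwise_cat o1 o2 !andbT; apply/allrelP => t u /sub1 <- /sub2 <-.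
  by rewrite mulrACA fg mulr0.
Qed.

(** If e p ^ i = r e p ^ j with i < j, multiplying by p ^ (k - j) kills the
right-hand side, whereas the exponent on the left stays below k. *)
Lemma uniserial_exponent_inj (A : comPzRingType) (e p : A) (k i j : nat) :
  uniserial_idempotent (e, p, k) -> (i <= k)%N -> (j <= k)%N ->
  principal_ideal (e * p ^+ i) = principal_ideal (e * p ^+ j) -> i = j.
Proof.
move=> [_ pk0 pj0 _].
wlog lt_ij : i j / (i < j)%N.
  move=> W ik jk eij; case: (ltngtP i j) => // lt_ij; first exact: W eij.
  by apply/esym; apply: W => //; apply/esym.
move=> ik jk /principal_ideal_eq_mem [r rE].
case: (pj0 (i + (k - j))%N).
  by rewrite -[X in (_ < X)%N](subnKC jk) ltn_add2r.
rewrite exprD mulrA rE -!mulrA -exprD subnKC //.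
by rewrite pk0 mulr0.
Qed.

Lemma principal_mul_eq0 (A : comPzRingType) (a a' b b' : A) :
  principal_ideal a = principal_ideal a' ->
  principal_ideal b = principal_ideal b' ->
  (a * b = 0 <-> a' * b' = 0).
Proof.
by move=> /asboolP ea /asboolP eb; split; apply: sim_mul_eq0; rewrite // sim_sym.
Qed.

Lemma uniserial_mul_eq0 (A : comPzRingType) (e p x y : A) (k i j : nat) :
  uniserial_idempotent (e, p, k) ->
  principal_ideal (x * e) = principal_ideal (e * p ^+ i) ->
  principal_ideal (y * e) = principal_ideal (e * p ^+ j) ->
  x * y * e = 0 <-> (k <= i + j)%N.
Proof.
move=> [ee pk0 pj0 _] xi yj.
have -> : x * y * e = (x * e) * (y * e) by rewrite mulrACA ee.
apply: iff_trans (principal_mul_eq0 xi yj) _.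
rewrite mulrACA ee -exprD; split=> [h|kij].
  by rewrite leqNgt; apply/negP => /pj0.
by rewrite -(subnKC kij) exprD mulrA pk0 mul0r.
Qed.

Lemma decomposition_coords (A : comPzRingType) (s : seq (A * A * nat)) :
  idempotent_decomposition 1 s ->
  exists v : A -> nat -> nat, staircase_coords [seq t.2 | t <- s] v.
Proof.
move=> [us sum1 _ orth].
pose t0 : A * A * nat := (0, 0, 0%N).
pose e i := (nth t0 s i).1.1; pose p i := (nth t0 s i).1.2.
pose k i := (nth t0 s i).2.
set n := size s.
have uni i : (i < n)%N -> uniserial_idempotent (e i, p i, k i).
  move=> ik; have := us _ (mem_nth t0 ik).
  by rewrite /e /p /k; case: (nth t0 s i) => [[]].
have kE i : (i < n)%N -> nth 0%N [seq t.2 | t <- s] i = k i.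
  by move=> ik; rewrite (nth_map t0).
have ee i : (i < n)%N -> e i * e i = e i by move=> /uni [].
have eo i j : (i < n)%N -> (j < n)%N -> i != j -> e i * e j = 0.
  move=> ik jk; have /(pairwiseP t0) o := orth.
  case: (ltngtP i j) => // [ij|ji] _; first by apply/eqP; apply: o.
  by rewrite mulrC; apply/eqP; apply: o.
have sume : \sum_(i < n) e i = 1.
  by rewrite -sum1 (big_nth t0) big_mkord.
have expand a : a = \sum_(i < n) a * e i by rewrite -mulr_sumr sume mulr1.
have [v vP] : exists v : A -> nat -> nat, forall a i, (i < n)%N ->
    (v a i <= k i)%N /\ principal_ideal (a * e i) = principal_ideal (e i * p i ^+ v a i).
  have h (ai : A * nat) : exists j, (ai.2 < n)%N -> (j <= k ai.2)%N /\
      principal_ideal (ai.1 * e ai.2) = principal_ideal (e ai.2 * p ai.2 ^+ j).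
    case: ai => a i /=; have [ik|] := boolP (i < n)%N; last by exists 0%N.
    by have [_ _ _ /(_ a) [j jk aE]] := uni i ik; exists j.
  by have [w wP] := choice h; exists (fun a i => w (a, i)) => a i /(wP (a, i)).
exists v; split; rewrite /bounded_by /eq_below size_map -/n.
- by move=> a i ik; rewrite kE //; have [] := vP a i ik.
- move=> d dks; exists (\sum_(i < n) e i * p i ^+ d i) => i ik.
  have [vk vE] := vP (\sum_(i < n) e i * p i ^+ d i) i ik.
  apply/esym; apply: (uniserial_exponent_inj (uni i ik)) => //.
    by rewrite -kE //; apply: dks.
  rewrite -vE mulr_suml (bigD1 (Ordinal ik)) //= big1 ?addr0.
    by rewrite mulrAC ee.
  by move=> j; rewrite -val_eqE => ji; rewrite mulrAC eo ?mul0r.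
- move=> a b eab.
  have half x y : (forall i, (i < n)%N -> v x i = v y i) -> principal_ideal y x.
    move=> exy; have [yI0 yID yIM] := principal_ideal_ideal y.
    rewrite (expand x); apply: (big_ind (principal_ideal y)) => // i _.
    have ik := ltn_ord i; have [_ xE] := vP x i ik; have [_ yE] := vP y i ik.
    have [|r ->] := @principal_ideal_eq_mem _ (x * e i) (y * e i).
      by rewrite xE yE exy.
    by exists (r * e i); ring.
  by apply: principal_ideal_eq; apply: half => // i ik; rewrite eab.
- have mulE a b i : (i < n)%N -> a * b * e i = 0 <-> (k i <= v a i + v b i)%N.
    move=> ik; have [_ aE] := vP a i ik; have [_ bE] := vP b i ik.
    exact: uniserial_mul_eq0 (uni i ik) aE bE.
  move=> a b; split=> [ab0 i ik|h].
    by rewrite kE //; apply/mulE => //; rewrite ab0 mul0r.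
  rewrite (expand (a * b)); apply: big1 => i _; have ik := ltn_ord i.
  by apply/mulE => //; rewrite -kE //; apply: h.
Qed.

Theorem theorem4p8 (A : comPzRingType) (hA : artinian A) :
  principal_ideal_ring A <->
  exists ks : seq nat, graph_iso (zeta A) (staircase_product ks).
Proof.
split=> [pir|[ks /graph_iso_coordsP [v hv]]].
  have [s /decomposition_coords sv] := exists_decomposition hA pir (mul1r 1).
  by exists [seq t.2 | t <- s]; apply/graph_iso_coordsP.
exact: staircase_coords_principal hv.
Qed.
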